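(* For $\tau_0> 0$ let $\tilde\nu(\tau_0)=1-2\tanh\tau_0$ and let $$D^{(3)}_*(\mu,\tau_0)=\frac{1}{2\pi}\,\delta\bigl(\mu-\tilde\nu(\tau_0)\bigr),\qquad \mu\in[-1,1],$$ where $\delta$ is the Dirac delta. Let $$D(\mu,\tau_0)=\sum_{l=0}^{+\infty}\frac{2l+1}{4\pi}\,P_l(\mu)\,\exp\bigl(-l(l+1)\tau_0\bigr),$$ where $P_l$ is the Legendre polynomial of degree $l$. Then the kernel $D_*=D_*^{(3)}$ satisfies the following three conditions: 1. $D_*(\mu,\tau_0)\ge 0$ and $2\pi\int_{-1}^{+1}D_*(\mu,\tau_0)\,d\mu=1$; 2. $\displaystyle\lim_{\tau_0\to0}D_*(\mu,\tau_0)=\frac{1}{2\pi}\,\delta(1-\mu)$; 3. $\displaystyle\lim_{\tau_0\to0}\frac{2\pi}{\tau_0}\int_{-1}^{+1}\bigl(D_*(\mu,\tau_0)-D(\mu,\tau_0)\bigr)P_l(\mu)\,d\mu=0$ for any $l=1,2,\dots$.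
   Context: The kernels $D_*(\cdot,\tau_0)$ are understood as (nonnegative) measures on $[-1,1]$: $\frac{1}{2\pi}\delta(\mu-a)$ with $a\in[-1,1]$ denotes $\frac1{2\pi}$ times the unit point mass at $\mu=a$, so that $\int_{-1}^{1} g(\mu)\,\delta(\mu-a)\,d\mu=g(a)$ for continuous $g$ on $[-1,1]$ (also when $a$ is an endpoint, e.g. $\delta(1-\mu)$ is the unit point mass at $\mu=1$). The limit in condition 2 is in the sense of weak convergence of measures on $[-1,1]$, and the limits are for $\tau_0\to0^+$. Legendre polynomials are normalized by $P_l(1)=1$. *)

(* Defs.v *)
From HB Require Import structures.
From mathcomp Require Export all_boot all_order all_algebra.
From mathcomp Require Export all_classical all_reals all_analysis.
Export Order.TTheory GRing.Theory Num.Theory numFieldNormedType.Exports.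

Set Implicit Arguments.
Unset Strict Implicit.
Unset Printing Implicit Defensive.

Local Open Scope classical_set_scope.
Local Open Scope ring_scope.

Definition tanh (R : realType) (x : R) : R :=
  (expR x - expR (- x)) / (expR x + expR (- x)).

(* Rodrigues' formula; this is the normalization P_l(1) = 1. *)
Definition legendre (R : realType) (l : nat) : {poly R} :=
  ((2 ^ l * l`!)%:R)^-1 *: (('X^2 - 1) ^+ l)^`(l).

(* A kernel on [-1, 1] is encoded as a measure on R of which only the trace on
   the closed interval matters: sets and integrals are always restricted to
   `[-1, 1]. *)
Lemma inv2pi_ge0 (R : realType) : 0 <= (2 * pi)^-1 :> R.
Proof. by rewrite invr_ge0 mulr_ge0 ?pi_ge0. Qed.

(* (1 / 2 pi) delta(mu - a) *)
Definition delta_kernel (R : realType) (a : R) :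
    {measure set (measurableTypeR R) -> \bar R} :=
  mscale (NngNum (inv2pi_ge0 R)) (dirac (a : measurableTypeR R)).

Definition nu3 (R : realType) (tau : R) : R := 1 - 2 * tanh tau.

Definition D3 (R : realType) (tau : R) :
    {measure set (measurableTypeR R) -> \bar R} :=
  delta_kernel (nu3 tau).

Definition D (R : realType) (mu tau : R) : R :=
  limn (fun n : nat => \sum_(0 <= l < n)
    (2 * l + 1)%:R / (4 * pi) * (legendre R l).[mu]
      * expR (- ((l * l.+1)%:R * tau))).

(* Weak convergence, as measures on [-1, 1], of a family of kernels as the
   parameter runs along the filter F. *)
Definition weak_cvg (R : realType)
    (K : R -> {measure set (measurableTypeR R) -> \bar R}) (F : set_system R)
    (m : {measure set (measurableTypeR R) -> \bar R}) : Prop :=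
  forall g : R -> R, {within `[-1, 1], continuous g} ->
    (\int[K tau]_(mu in `[-1, 1]) g mu) @[tau --> F]
      --> \int[m]_(mu in `[-1, 1]) g mu.

(* Integral over [-1, 1] of g against the signed measure m - f(mu) dmu. *)
Definition int_diff (R : realType)
    (m : {measure set (measurableTypeR R) -> \bar R}) (f g : R -> R) : R :=
  \int[m]_(mu in `[-1, 1]) g mu
    - \int[lebesgue_measure]_(mu in `[-1, 1]) (f mu * g mu).

(* Main.v *)
Require Import Defs.
From mathcomp Require Import measurable_realfun ring lra zify.

(* Since [D] is the Legendre expansion with coefficients e^{-l(l+1)tau},
   orthogonality gives 2 pi int D P_l = e^{-l(l+1)tau}, while
   2 pi int D3 P_l = P_l(1 - 2 tanh tau). Condition 3 thus says that these two
   functions of tau have the same derivative at 0, which holds because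
   P_l'(1) = l(l+1)/2 and tanh'(0) = 1. Exchanging sum and integral only needs
   the crude bound |P_l| <= 4^l on [-1, 1], as the Gaussian decay of the
   coefficients beats any geometric growth. *)

Set Implicit Arguments.
Unset Strict Implicit.
Unset Printing Implicit Defensive.

Local Open Scope classical_set_scope.
Local Open Scope ring_scope.

(** * Legendre polynomials *)

(** Leibniz' rule: for derivatives divided by n! the binomial coefficients disappear. The induction
    runs over the Horner form of [p]. *)
Lemma nderivnMl (A : comNzRingType) (p q : {poly A}) n :
  (p * q)^`N(n) = \sum_(i < n.+1) p^`N(i) * q^`N(n - i).
Proof.
elim/poly_ind: p n => [|p c IHp] n.
  by rewrite mul0r nderivnC big1 => [|i _]; rewrite ?nderivnC; case: ifP; rewrite ?mul0r.
(* The dummy constant [0%:P] gives the first summand the shape expected by [nderivnMXaddC]. *)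
have -> : (p * 'X + c%:P) * q = (p * q) * 'X + 0%:P + c *: q.
  by rewrite polyC0 addr0 mulrDl mulrAC mul_polyC.
rewrite nderivnD nderivnZ big_ord_recl subn0 !nderivn0.
case: n => [|n].
  by rewrite big_ord0 !nderivn0; ring: (mul_polyC c q).
rewrite nderivnMXaddC !IHp.
have -> : \sum_(i < n.+1) (p * 'X + c%:P)^`N(lift ord0 i) * q^`N(n.+1 - lift ord0 i)
    = \sum_(i < n.+1) p^`N(i) * q^`N(n - i)
      + (\sum_(i < n.+1) p^`N(i.+1) * q^`N(n - i)) * 'X.
  rewrite mulr_suml -big_split; apply: eq_bigr => i _.
  by rewrite (lift0 i) subSS nderivnMXaddC mulrDl [_ * 'X * _]mulrAC.
rewrite [\sum_(i < n.+2) _]big_ord_recl nderivn0 subn0 -mul_polyC.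
under [X in _ + (_ + X) * _ + _]eq_bigr => i _ do rewrite (lift0 i) subSS.
ring.
Qed.

Lemma nderivn_exp_XsubC (A : comNzRingType) (a : A) m n :
  (('X - a%:P) ^+ m)^`N(n) = ('X - a%:P) ^+ (m - n) *+ 'C(m, n).
Proof.
elim: m n => [|m IHm] [|n]; rewrite ?nderivn0 ?subn0 ?bin0 //.
  by rewrite expr0 nderivnC /= mulr0n.
rewrite exprS mulrBl -commr_polyX mul_polyC -[_ * 'X]addr0 -polyC0 nderivnB nderivnZ.
rewrite nderivnMXaddC !IHm subSS binS mulrnDr -mul_polyC -addrA [RHS]addrC; congr (_ + _).
(* For m <= n truncated subtraction breaks the identity of exponents, but the coefficient 'C(m,
   n.+1) is then 0. *)
case: (ltnP n m) => [nm|mn]; last by rewrite bin_small // !mulr0n; ring.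
rewrite -(subnSK nm) exprS mulrnAl mulrnAr -mulrnBl; congr (_ *+ _); ring.
Qed.

Lemma monic_derivn (A : nzRingType) (p : {poly A}) n :
  p \is monic -> size p = n.+1 -> p^`(n) = n`!%:R%:P.
Proof.
move=> pm sp; apply/polyP => i; rewrite coef_derivn coefC.
case: i => [|i].
  by rewrite addn0 ffactnn; move/monicP: pm; rewrite lead_coefE sp => ->.
by rewrite nth_default ?mul0rn // sp addnS ltnS leq_addr.
Qed.

Lemma X2sub1 (A : comNzRingType) : 'X^2 - 1 = ('X - 1%:P) * ('X - (- 1)%:P) :> {poly A}.
Proof. by rewrite polyCN; ring. Qed.

Lemma nderivn_X2sub1 (A : comNzRingType) l n : (('X^2 - 1 : {poly A}) ^+ l)^`N(n)
  = \sum_(i < n.+1) ('X - 1%:P) ^+ (l - i) * ('X - (- 1)%:P) ^+ (l - (n - i))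
      *+ ('C(l, i) * 'C(l, n - i)).
Proof.
rewrite X2sub1 exprMn nderivnMl; apply: eq_bigr => i _.
by rewrite !nderivn_exp_XsubC mulrnAl mulrnAr -mulrnA mulnC.
Qed.

(** Both 1 and -1 are zeros of order l of (X^2 - 1)^l, so each Leibniz term keeps a positive power
    of either factor. These values are the boundary terms of the later integrations by parts. *)
Lemma derivn_X2sub1_pm1 (A : comNzRingType) l n : (n < l)%N ->
  (('X^2 - 1 : {poly A}) ^+ l)^`(n).[1] = 0 /\
  (('X^2 - 1 : {poly A}) ^+ l)^`(n).[-1] = 0.
Proof.
move=> nl; rewrite nderivn_def nderivn_X2sub1 !hornerMn !horner_sum.
split; rewrite big1 ?mul0rn // => i _;
  rewrite hornerMn hornerM !horner_exp !hornerXsubC subrr expr0n subn_eq0 leqNgt.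
- by rewrite (leq_ltn_trans _ nl) ?mul0r ?mul0rn // -ltnS.
- by rewrite (leq_ltn_trans (leq_subr _ _) nl) mulr0 mul0rn.
Qed.

Section legendre.
Variable R : realType.
Local Notation P := (legendre R).

Lemma legendre_nderivn l : P l = (2 ^+ l)^-1 *: (('X^2 - 1) ^+ l)^`N(l).
Proof.
rewrite /legendre nderivn_def -[X in _ *: X]scaler_nat scalerA natrM natrX invfM.
by rewrite -mulrA mulVf ?mulr1 // pnatr_eq0 -lt0n fact_gt0.
Qed.

(** Leibniz' rule on (X - 1)^l (X + 1)^l. In this form only one term survives at 1, and every term
    is easily bounded on [-1, 1]. *)
Lemma legendreE l (x : R) : (P l).[x] = (2 ^+ l)^-1 *
  \sum_(i < l.+1) (x - 1) ^+ (l - i) * (x + 1) ^+ i *+ 'C(l, i) ^ 2.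
Proof.
rewrite legendre_nderivn nderivn_X2sub1 hornerZ horner_sum; congr (_ * _).
apply: eq_bigr => i _; have il : (i <= l)%N by rewrite -ltnS.
by rewrite hornerMn hornerM !horner_exp !hornerXsubC opprK subKn // bin_sub // mulnn.
Qed.

Lemma legendre1 l : (P l).[1] = 1.
Proof.
rewrite legendreE big_ord_recr big1 => [|i _] /=.
  by rewrite subnn expr0 mul1r binn exp1n mulr1n add0r mulVf // expf_neq0 ?pnatr_eq0.
by rewrite subrr expr0n subn_eq0 leqNgt ltn_ord mul0r mul0rn.
Qed.

(** By Rodrigues, P_l' is (l + 1) / 2^l times a normalized derivative of order l + 1. At 1 only the
    Leibniz term taking l derivatives on (X - 1)^l and one on (X + 1)^l survives; it equals l
    2^(l-1). *)
Lemma legendre_deriv1 l : (P l)^`().[1] = (l * l.+1)%:R / 2.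
Proof.
have -> : (P l)^`() = (2 ^+ l)^-1 *: (('X^2 - 1) ^+ l)^`N(l.+1) *+ l.+1.
  rewrite /legendre derivZ -derivnS nderivn_def -[RHS]scaler_nat.
  rewrite -[X in _ *: X = _]scaler_nat !scalerA; congr (_ *: _).
  rewrite factS !natrM natrX; field.
  by rewrite pnatr_eq0 -lt0n fact_gt0 expf_neq0 ?pnatr_eq0.
rewrite hornerMn hornerZ nderivn_X2sub1 horner_sum 2!big_ord_recr.
rewrite big1 => [|i _] /=; last first.
  rewrite hornerMn hornerM !horner_exp !hornerXsubC.
  by rewrite subrr expr0n subn_eq0 leqNgt ltn_ord mul0r mul0rn.
rewrite add0r (@bin_small l l.+1) // mul0n mulr0n horner0 addr0.
rewrite subnn subSnn binn bin1 mul1n expr0 mul1r.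
rewrite hornerMn horner_exp hornerXsubC opprK.
rewrite -[LHS]mulr_natr -[X in _ * X * _]mulr_natr natrM.
(* The exponent l - 1 is truncated at l = 0, where both sides vanish. *)
case: l => [|l]; first by rewrite ?(mulr0, mul0r).
rewrite subSS subn0 exprS; field.
by rewrite expf_neq0 ?pnatr_eq0.
Qed.

(** In [legendreE] use |x - 1|, |x + 1| <= 2 and 'C(l, i)^2 <= 2^l 'C(l, i); the binomials sum to
    2^l, so the sum is at most 8^l, to be divided by 2^l. *)
Lemma norm_legendre_le l (x : R) : -1 <= x <= 1 -> `|(P l).[x]| <= 4 ^+ l.
Proof.
move=> /andP[x1 x2]; rewrite legendreE normrM ger0_norm ?invr_ge0 ?exprn_ge0 //.
rewrite ler_pdivrMl ?exprn_gt0 //.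
apply: (@le_trans _ _ (\sum_(i < l.+1) 2 ^+ l * (2 ^+ l * 'C(l, i)%:R))).
  apply: (le_trans (ler_norm_sum _ _ _)); apply: ler_sum => i _.
  have il : (i <= l)%N by rewrite -ltnS.
  rewrite normrMn normrM !normrX.
  have h1 : `|x - 1| ^+ (l - i) * `|x + 1| ^+ i <= 2 ^+ l.
    rewrite -[X in _ <= _ ^+ X](subnK il) exprD ler_pM ?exprn_ge0 //; apply: lerXn2r;
      rewrite ?nnegrE // ler_norml; apply/andP; split; lra.
  apply: (le_trans (ler_wMn2r _ h1)).
  rewrite -[_ *+ _ ^ 2]mulr_natr ler_wpM2l ?exprn_ge0 // natrX expr2 ler_wpM2r //.
  rewrite -natrX ler_nat.
  (* A binomial coefficient is one term of the expansion of (1 + 1)^l. *)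
  rewrite -[2%N]/(1 + 1)%N expnDn (bigD1 (Ordinal (il : (i < l.+1)%N))) //= !exp1n !muln1.
  exact: leq_addr.
rewrite -mulr_sumr -mulr_sumr -natr_sum.
have -> : (\sum_(i < l.+1) 'C(l, i) = 2 ^ l)%N.
  by rewrite -[2%N]/(1 + 1)%N expnDn; apply: eq_bigr => i _; rewrite !exp1n !muln1.
by rewrite natrX -exprMn -natrM.
Qed.

End legendre.

(** * Orthogonality *)

Section integral_poly.
Variable R : realType.
Local Notation P := (legendre R).
Implicit Types p q : {poly R}.

Definition integral_poly p : R := \int[lebesgue_measure]_(x in `[-1, 1]) p.[x].
Local Notation J := integral_poly.

Lemma integrable_horner p :
  (@lebesgue_measure R).-integrable `[-1, 1] (EFin \o horner p).
Proof.
apply: continuous_compact_integrable; first exact: segment_compact.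
exact/continuous_subspaceT/continuous_horner.
Qed.

Lemma integral_polyD p q : J (p + q) = J p + J q.
Proof.
rewrite /J -RintegralD //; [|exact: integrable_horner..].
by apply: eq_Rintegral => x _; rewrite hornerD.
Qed.

Lemma integral_polyZ c p : J (c *: p) = c * J p.
Proof.
rewrite /J -RintegralZl //; last exact: integrable_horner.
by apply: eq_Rintegral => x _; rewrite hornerZ.
Qed.

Lemma integral_poly_sum (I : Type) (r : seq I) (F : I -> {poly R}) :
  J (\sum_(i <- r) F i) = \sum_(i <- r) J (F i).
Proof.
apply: (big_morph J integral_polyD).
by rewrite -[0](scale0r (0 : {poly R})) integral_polyZ mul0r.
Qed.

Lemma integral_deriv p : J p^`() = p.[1] - p.[-1].
Proof.
rewrite /J /Rintegral (@continuous_FTC2 _ _ (horner p)) //.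
- exact/continuous_subspaceT/continuous_horner.
- split.
  + by move=> x _; exact: derivable_horner.
  + by apply: cvg_at_right_filter; exact: continuous_horner.
  + by apply: cvg_at_left_filter; exact: continuous_horner.
- by move=> x _; rewrite derivE.
Qed.

Lemma integral_by_parts p q : p.[1] = 0 -> p.[-1] = 0 ->
  J (p^`() * q) = - J (p * q^`()).
Proof.
move=> p1 pN1; apply/eqP; rewrite -addr_eq0 -integral_polyD -derivM integral_deriv.
by rewrite !hornerM p1 pN1 !mul0r subrr.
Qed.

Lemma integral_by_parts_X2sub1 l q :
  J ((('X^2 - 1) ^+ l)^`(l) * q) = (-1) ^+ l * J (('X^2 - 1) ^+ l * q^`(l)).
Proof.
(* Induction on the number k of derivatives already moved onto [q]. *)
suff H k : (k <= l)%N -> J ((('X^2 - 1) ^+ l)^`(l) * q) =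
    (-1) ^+ k * J ((('X^2 - 1) ^+ l)^`(l - k) * q^`(k)).
  by rewrite (H l) // subnn.
elim: k => [|k IHk] kl; first by rewrite mul1r subn0.
rewrite IHk ?(ltnW kl) // -(subnSK kl) derivnS.
have lk : (l - k.+1 < l)%N by rewrite ltn_subrL (leq_ltn_trans _ kl).
have [h1 hN1] := derivn_X2sub1_pm1 R lk.
by rewrite integral_by_parts // [(-1) ^+ k.+1]exprS mulN1r mulrN mulNr.
Qed.

Lemma monic_X2sub1 (A : nzRingType) l : ('X^2 - 1 : {poly A}) ^+ l \is monic.
Proof. by rewrite monic_exp // -polyC1 monicXnsubC. Qed.

Lemma size_X2sub1 (A : idomainType) l : size (('X^2 - 1 : {poly A}) ^+ l) = l.*2.+1.
Proof.
by rewrite polySpred ?monic_neq0 ?monic_X2sub1 // size_exp -polyC1 size_XnsubC // mul2n.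
Qed.

(** The polynomial X (X^2 - 1)^(l+1) vanishes at 1 and -1, so its derivative has integral 0. Writing
    X^2 = (X^2 - 1) + 1 in that derivative yields (2l + 3) J_(l+1) = -(2l + 2) J_l. *)
Lemma integral_X2sub1 l : J (('X^2 - 1) ^+ l) =
  (-1) ^+ l * 2 * (2 ^+ l * l`!%:R) ^+ 2 / (l.*2.+1)`!%:R.
Proof.
elim: l => [|l IHl].
  have -> : ('X^2 - 1) ^+ 0 = ('X : {poly R})^`() by rewrite derivX.
  by rewrite integral_deriv !hornerX opprK !expr0 !mul1r expr1n divr1 mulr1.
have E : ('X * ('X^2 - 1) ^+ l.+1)^`() =
    (2 * l + 3)%:R *: ('X^2 - 1) ^+ l.+1 + (2 * l.+1)%:R *: ('X^2 - 1) ^+ l :> {poly R}.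
  rewrite derivM derivX deriv_exp /= derivB derivXn derivC subr0 expr1 exprS.
  rewrite -!mul_polyC !raddfMn /= polyC1.
  rewrite -[_ *+ l.+1]mulr_natr.
  move: (_ ^+ l) => u.
  ring.
have := integral_deriv ('X * ('X^2 - 1) ^+ l.+1).
rewrite E integral_polyD !integral_polyZ IHl.
have h a : a ^+ 2 = 1 -> ('X * ('X^2 - 1) ^+ l.+1).[a] = 0 :> R.
  by move=> a1; rewrite hornerM horner_exp !hornerE a1 subrr expr0n mulr0.
rewrite !h ?sqrrN ?expr1n // subrr => /eqP; rewrite addr_eq0 => /eqP {}E.
have n3 : (2 * l + 3)%:R != 0 :> R by rewrite pnatr_eq0 addnS.
have F0 : (l.*2.+1)`!%:R != 0 :> R by rewrite pnatr_eq0 -lt0n fact_gt0.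
apply: (mulfI n3); rewrite {}E doubleS !factS !exprS !natrM.
have -> : l.*2.+3 = (2 * l + 3)%N by lia.
have -> : l.*2.+2%:R = 2 * l.+1%:R :> R by rewrite -natrM; congr _%:R; lia.
field.
by rewrite pnatr_eq0 -lt0n fact_gt0 -!(natrD _ 1) -natrM -natrD !pnatr_eq0 addnS.
Qed.

(** For k <= l, Rodrigues' formula for P_l and l integrations by parts move l derivatives onto P_k:
    the result is 0 if k < l and a constant if k = l, which leaves [integral_X2sub1]. *)
Lemma integral_legendreM k l : J (P k * P l) = (k == l)%:R * 2 / (2 * l + 1)%:R.
Proof.
wlog kl : k l / (k <= l)%N.
  move=> H; case: (leqP k l) => [/H //|lk].
  by rewrite mulrC H ?(ltnW lk) // eq_sym; case: eqP => [->//|]; rewrite !mul0r.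
have E : J (P k * P l) = (-1) ^+ l / (2 ^+ l * l`!%:R) *
    J ((P k)^`(l) * ('X^2 - 1) ^+ l).
  rewrite mulrC {1}/legendre -scalerAl integral_polyZ integral_by_parts_X2sub1.
  by rewrite [(P k)^`(l) * _]mulrC natrM natrX; ring.
rewrite {}E; case: eqP => [->|/eqP nkl].
  (* Up to the Rodrigues factor this is the derivative of order 2l of a monic polynomial of degree
     2l. *)
  have -> : (P l)^`(l) = (l.*2`!%:R / (2 ^+ l * l`!%:R))%:P.
    rewrite /legendre derivnZ /derivn -iterD addnn -/(derivn _ _).
    rewrite (monic_derivn (monic_X2sub1 _ _)) ?size_X2sub1 // -mul_polyC -polyCM.
    by rewrite mulrC natrM natrX.
  rewrite mul_polyC integral_polyZ integral_X2sub1.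
  set s := (-1) ^+ l.
  have ss : s * s = 1 by rewrite /s -exprD addnn -signr_odd odd_double.
  set c := 2 ^+ l * _.
  have c0 : c != 0 by rewrite mulf_neq0 ?expf_neq0 ?pnatr_eq0 // -lt0n fact_gt0.
  have F0 : (2 * l)`!%:R != 0 :> R by rewrite pnatr_eq0 -lt0n fact_gt0.
  have n1 : (2 * l + 1)%:R != 0 :> R by rewrite pnatr_eq0 addn1.
  have -> : l.*2.+1 = (2 * l).+1 by rewrite mul2n.
  rewrite factS natrM -(addn1 (2 * l)) mul2n mul1r -[l.*2]mul2n.
  transitivity (s * s * 2 / (2 * l + 1)%:R); last by rewrite ss mul1r.
  move: (2 * l + 1)%N n1 => n n1; move: (_`!%:R) F0 => F F0.
  by field; rewrite n1 F0 c0.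
(* A polynomial of degree 2k is differentiated k + l > 2k times. *)
have -> : (P k)^`(l) = 0.
  rewrite /legendre derivnZ /derivn -iterD -/(derivn _ _) derivn_poly0 ?scaler0 //.
  by rewrite size_X2sub1 -addnn -addSn leq_add2r ltn_neqAle nkl.
by rewrite mul0r -[0](scale0r (0 : {poly R})) integral_polyZ !mul0r mulr0.
Qed.

End integral_poly.

(** * The heat kernel *)

Section heat.
Variable R : realType.
Implicit Types tau x : R.
Local Notation P := (legendre R).

Definition heat_coef tau k : R :=
  (2 * k + 1)%:R / (4 * pi) * expR (- ((k * k.+1)%:R * tau)).

Lemma heat_coef_ge0 tau k : 0 <= heat_coef tau k.
Proof. by rewrite mulr_ge0 ?expR_ge0 // divr_ge0 // mulr_ge0 // pi_ge0. Qed.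

(** The factor 4^k stands for the bound on |P_k|; what remains is a summable geometric series with a
    constant depending on [tau] alone. *)
Lemma heat_coef_bound tau k : 0 < tau ->
  heat_coef tau k * 4 ^+ k <= expR (144 / tau) * 2^-1 ^+ k.
Proof.
move=> tau0; rewrite exprVn ler_pdivlMr ?exprn_gt0 // -mulrA -exprMn.
have h3 : (2 * k + 1)%:R / (4 * pi) <= 3 ^+ k :> R.
  rewrite ler_pdivrMr ?mulr_gt0 ?pi_gt0 //; apply: (@le_trans _ _ (3 ^+ k)).
    rewrite -natrX ler_nat; elim: k => // k IHk; rewrite expnS; lia.
  rewrite ler_peMr ?exprn_ge0 //; have := @pi_ge2 R; lra.
(* 24 = 3 * 4 * 2: the bound 3^k on the prefactor, the factor 4^k, and the 2^k moved over from the
   right-hand side. *)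
apply: (@le_trans _ _ (24 ^+ k * expR (- ((k * k.+1)%:R * tau)))).
  rewrite mulrAC ler_wpM2r ?expR_ge0 //.
  apply: le_trans (ler_wpM2r _ h3) _; first by rewrite exprn_ge0.
  by rewrite -exprMn; apply: lerXn2r; rewrite ?nnegrE -?natrM.
apply: (@le_trans _ _ (expR 24 ^+ k * expR (- ((k * k.+1)%:R * tau)))).
  rewrite ler_wpM2r ?expR_ge0 //; apply: lerXn2r; rewrite ?nnegrE ?expR_ge0 //.
  by apply: le_trans (expR_ge1Dx _); lra.
rewrite -expRM_natl -expRD ler_expR -subr_ge0 natrM -[k.+1%:R]natr1.
(* Completing the square in [24 k - k^2 tau] produces the constant 144 = 24^2 / 4. *)
rewrite [X in 0 <= X](_ : _ = tau * (k%:R - 12 / tau) ^+ 2 + k%:R * tau).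
  by rewrite addr_ge0 // mulr_ge0 ?sqr_ge0 // ltW.
by field; rewrite gt_eqF.
Qed.

Lemma sum_half n : \sum_(0 <= k < n) 2^-1 ^+ k <= 2 :> R.
Proof.
suff -> : \sum_(0 <= k < n) 2^-1 ^+ k = 2 - 2 * 2^-1 ^+ n :> R.
  by rewrite gerBl mulr_ge0 // exprn_ge0 // invr_ge0.
elim: n => [|n IHn]; first by rewrite big_nil expr0 mulr1 subrr.
by rewrite big_nat_recr //= IHn exprS; field.
Qed.

(** The partial sums of [D], kept as polynomials so that [integral_poly] and its linearity apply. *)
Definition heat_poly tau n : {poly R} :=
  \sum_(0 <= k < n) heat_coef tau k *: P k.

Lemma heat_polyE tau n x : (heat_poly tau n).[x] =
  \sum_(0 <= k < n) (2 * k + 1)%:R / (4 * pi) * (P k).[x]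
    * expR (- ((k * k.+1)%:R * tau)).
Proof.
by rewrite horner_sum; apply: eq_bigr => k _; rewrite hornerZ mulrAC.
Qed.

Lemma norm_heat_term_le tau k x : 0 < tau -> -1 <= x <= 1 ->
  `|heat_coef tau k * (P k).[x]| <= expR (144 / tau) * 2^-1 ^+ k.
Proof.
move=> tau0 x1; apply: le_trans (heat_coef_bound k tau0).
by rewrite normrM ger0_norm ?heat_coef_ge0 // ler_wpM2l ?heat_coef_ge0 ?norm_legendre_le.
Qed.

(** Uniform in [n] and [x], as dominated convergence requires. *)
Lemma norm_heat_poly_le tau n x : 0 < tau -> -1 <= x <= 1 ->
  `|(heat_poly tau n).[x]| <= expR (144 / tau) * 2.
Proof.
move=> tau0 x1; rewrite horner_sum; apply: (le_trans (ler_norm_sum _ _ _)).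
apply: (@le_trans _ _ (\sum_(0 <= k < n) expR (144 / tau) * 2^-1 ^+ k)).
  by apply: ler_sum => k _; rewrite hornerZ norm_heat_term_le.
by rewrite -mulr_sumr ler_wpM2l ?expR_ge0 ?sum_half.
Qed.

(** [D] is a bare [limn], so convergence has to be established; it is absolute, by comparison with a
    geometric series. *)
Lemma cvg_heat_poly tau x : 0 < tau -> -1 <= x <= 1 ->
  (heat_poly tau n).[x] @[n --> \oo] --> D x tau.
Proof.
move=> tau0 x1.
pose u k := heat_coef tau k * (P k).[x].
have uE : (fun n => (heat_poly tau n).[x]) = series u.
  by apply/funext => n; rewrite horner_sum; apply: eq_bigr => k _; rewrite hornerZ.
have -> : D x tau = limn (series u).
  rewrite -uE /D; set v := (X in limn X); set w := (X in _ = limn X).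
  by have -> : v = w by apply/funext => n; rewrite /w heat_polyE.
rewrite uE; suff : cvgn [normed series u] by move=> h; exact: (normed_cvg h).
apply: (series_le_cvg _ _ (fun k => norm_heat_term_le k tau0 x1)) => //.
by apply: is_cvg_geometric_series; rewrite ger0_norm ?invr_ge0 // invf_lt1 // ltr1n.
Qed.

Lemma integral_heat_polyM tau n l : (l < n)%N ->
  integral_poly (heat_poly tau n * P l) = expR (- ((l * l.+1)%:R * tau)) / (2 * pi).
Proof.
move=> ln; rewrite mulr_suml integral_poly_sum.
under eq_bigr => k _ do rewrite -scalerAl integral_polyZ integral_legendreM.
rewrite (bigD1_seq l) ?iota_uniq ?mem_index_iota //=.
rewrite big1 => [|k /negPf ->]; last by rewrite !mul0r mulr0.
have n0 : (2 * l + 1)%:R != 0 :> R by rewrite pnatr_eq0 addn1.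
have pi0 : pi != 0 :> R by rewrite gt_eqF ?pi_gt0.
rewrite eqxx addr0 /heat_coef mul1r.
move: pi pi0 (2 * l + 1)%:R n0 (expR _) => p p0 m m0 e.
by field; rewrite m0 p0.
Qed.

Lemma integral_heat tau l : 0 < tau ->
  \int[lebesgue_measure]_(x in `[-1, 1]) (D x tau * (P l).[x]) =
  expR (- ((l * l.+1)%:R * tau)) / (2 * pi).
Proof.
move=> tau0; set c := RHS.
pose f_ n := EFin \o horner (heat_poly tau n * P l).
have mf_ n := measurable_int _ (integrable_horner (heat_poly tau n * P l)).
pose f x := (D x tau * (P l).[x])%:E.
have cf x : (`[-1, 1]%classic : set R) x -> f_ ^~ x @ \oo --> f x.
  rewrite /= in_itv /= => x1; apply: cvg_EFin; first exact: nearW.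
  have -> : fine \o f_^~ x = (fun n => (heat_poly tau n).[x] * (P l).[x]).
    by apply/funext => n; rewrite /= hornerM.
  by apply: cvgMr_tmp; apply: cvg_heat_poly.
have mf := emeasurable_fun_cvg f_ f mf_ cf.
(* The dominating function is constant: the bound on the partial sums times the bound 4^l on P_l. *)
have ig := integrable_horner (expR (144 / tau) * 2 * 4 ^+ l)%:P.
have [|||_ _ cI] := dominated_convergence _ mf_ mf _ ig _; first by [].
- exact: aeW.
- apply: aeW => x n; rewrite /= in_itv /= => x1.
  by rewrite lee_fin hornerC hornerM normrM ler_pM ?norm_heat_poly_le ?norm_legendre_le.
(* By orthogonality the integrals are constant as soon as n > l. *)
have cc : (\int[lebesgue_measure]_(x in `[(-1)%R, 1%R]) (f_ n x))%E @[n --> \oo] --> c%:E.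
  apply: cvg_near_cst; near=> n.
  rewrite /c -(@integral_heat_polyM _ n); last by near: n; exact: nbhs_infty_gt.
  rewrite /integral_poly /Rintegral fineK //; apply: integrable_fin_num => //.
  exact: integrable_horner.
by have e := cvg_unique _ cI cc; rewrite /Rintegral e.
Unshelve. all: by end_near. Qed.

End heat.

(** * The delta kernel *)

Section delta.
Variable R : realType.
Implicit Types a tau : R.

Lemma ge0_integral_delta a (A : set (measurableTypeR R)) g :
  measurable A -> A a -> measurable_fun A g -> (forall x, A x -> (0 <= g x)%E) ->
  (\int[delta_kernel a]_(x in A) g x = ((2 * pi)^-1)%:E * g a)%E.
Proof.
move=> mA Aa mg g0; rewrite ge0_integral_mscale //= integral_dirac //.
by rewrite diracE mem_set ?mul1e.
Qed.

Lemma Rintegral_delta a (A : set (measurableTypeR R)) (g : R -> R) :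
  measurable A -> A a -> measurable_fun A g ->
  \int[delta_kernel a]_(x in A) g x = g a / (2 * pi).
Proof.
move=> mA Aa /measurable_EFinP mg.
rewrite /Rintegral integralE !ge0_integral_delta //.
(* The difference of positive and negative parts at [a] is well defined, so the scalar factors out
   and they recombine into [g a]. *)
- rewrite -muleBr ?add_def_funeposneg //.
  rewrite -[X in (_ * X)%E](congr1 (@^~ a) (funeposneg (EFin \o g))).
  by rewrite /= mulrC.
- exact: measurable_funeneg.
- exact: measurable_funepos.
Qed.

Lemma tanh_is_derive0 : is_derive (0 : R) 1 (@tanh R) 1.
Proof.
have HN : is_derive (0 : R) 1 (expR \o -%R) (expR (- 0) * -1) by exact: is_derive1_comp.
have HD := is_deriveD (is_derive_expR 0) HN.
have HB := is_deriveB (is_derive_expR 0) HN.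
have c0 : (expR + (expR \o -%R)) (0 : R) != 0.
  by rewrite /= !fctE /= oppr0 expR0 -(natrD _ 1 1) pnatr_eq0.
have HV := is_deriveV c0 HD.
have HM := is_deriveM HB HV.
apply: (is_derive_eq HM).
rewrite !fctE /= oppr0 expR0 subrr scale0r add0r mul1r opprK.
by rewrite -[_ *: _]/(_ * _) mulVf // -(natrD _ 1 1) pnatr_eq0.
Qed.

Lemma tanh_ge0_le1 tau : 0 <= tau -> 0 <= tanh tau <= 1.
Proof.
move=> tau0; have e0 := expR_gt0 tau; have eN0 := expR_gt0 (- tau).
have le : expR (- tau) <= expR tau by rewrite ler_expR; lra.
by rewrite /tanh divr_ge0 /= ?ler_pdivrMr; lra.
Qed.

Lemma nu3_itv tau : 0 < tau -> (`[-1, 1]%classic : set R) (nu3 tau).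
Proof. by move=> /ltW/tanh_ge0_le1 /andP[? ?]; rewrite /= in_itv /= /nu3; lra. Qed.

(** Strictness makes [nu3] tend to 1 from the left, the only side on which a test function on
    [-1, 1] is controlled. *)
Lemma nu3_lt1 tau : 0 < tau -> nu3 tau < 1.
Proof.
move=> tau0; rewrite /nu3 gtrBl mulr_gt0 // /tanh divr_gt0 //.
  by rewrite subr_gt0 ltr_expR; lra.
by rewrite addr_gt0 ?expR_gt0.
Qed.

Lemma nu3_is_derive0 : is_derive (0 : R) 1 (@nu3 R) (- 2).
Proof.
have H := tanh_is_derive0.
have HZ := is_deriveZ 2 H.
have HB := is_deriveB (is_derive_cst (1 : R) (0 : R) 1) HZ.
apply: (is_derive_eq HB).
by rewrite sub0r -[_ *: _]/(_ * _) mulr1.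
Qed.

Lemma nu30 : nu3 (0 : R) = 1.
Proof. by rewrite /nu3 /tanh oppr0 subrr mul0r mulr0 subr0. Qed.

Lemma cvg_nu3 : nu3 tau @[tau --> (0 : R)^'+] --> (1 : R).
Proof.
rewrite -nu30; apply: cvg_at_right_filter; apply: differentiable_continuous.
by apply/derivable1_diffP; case: nu3_is_derive0.
Qed.

Lemma is_derive_cvg_right (f : R -> R) (x df : R) : is_derive x 1 f df ->
  (f (x + h) - f x) / h @[h --> 0^'+] --> df.
Proof.
case=> df1 <-; apply: cvg_dnbhs_at_right; move: df1; rewrite /derivable /derive.
set F := (X in cvg (X @ _) -> _).
set G := (X in _ -> X @ _ --> _).
suff -> : G = F by [].
apply/funext => h; rewrite /F /G /= (_ : h%:A = h :> R); last exact: mulr1.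
by rewrite (addrC h) -[RHS]/(_ * _) mulrC.
Qed.

Lemma weak_cvg_D3 : weak_cvg (@D3 R) 0^'+ (delta_kernel 1).
Proof.
move=> g cg.
have mg := subspace_continuous_measurable_fun (measurable_itv _) cg.
have lt11 : (-1 : R) < 1 by rewrite (@lt_trans _ _ 0) ?ltrN10.
rewrite Rintegral_delta //; last by rewrite /= in_itv /= lexx ltW.
(* A set in the left filter at 1 is only known to contain the points below 1 near 1, hence the
   appeal to [nu3_lt1]. *)
have cnu : nu3 tau @[tau --> (0 : R)^'+] --> (1 : R)^'-.
  move=> A A1.
  have h1 : \forall tau \near (0 : R)^'+, nu3 tau < 1 -> A (nu3 tau) := cvg_nu3 A1.
  have h2 : \forall tau \near (0 : R)^'+, 0 < tau by exact: nbhs_right_gt.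
  by apply: filterS2 h1 h2 => tau h t0; apply: h; exact: nu3_lt1.
have [_ _ g1] := (continuous_within_itvP g lt11).1 cg.
have := cvgMr_tmp (b := (2 * pi)^-1) (cvg_comp _ _ cnu g1).
move=> /(_ (at_right_proper_filter 0)); apply: cvg_trans; apply: near_eq_cvg; near=> tau.
have tau0 : 0 < tau by near: tau; exact: nbhs_right_gt.
by rewrite /D3 Rintegral_delta //; exact: nu3_itv.
Unshelve. all: by end_near. Qed.

Lemma total_mass_D3 tau : 0 < tau ->
  ((2 * pi)%:E * \int[D3 tau]_(mu in `[(-1)%R, 1%R]) 1 = 1)%E.
Proof.
move=> tau0.
rewrite /D3 ge0_integral_delta //; last exact: nu3_itv.
by rewrite mule1 -EFinM divff // mulf_neq0 // gt_eqF ?pi_gt0.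
Qed.

Lemma cvg_D3_sub_D l :
  (2 * pi / tau
     * int_diff (D3 tau) (fun mu => D mu tau) (fun mu => (legendre R l).[mu]))
     @[tau --> 0^'+] --> (0 : R).
Proof.
(* For tau > 0 this is 2 pi times [int_diff]; since f(0) = 0, the quantity in the limit is the
   difference quotient of [f] at 0. *)
pose f tau : R := (legendre R l).[nu3 tau] - expR (- ((l * l.+1)%:R * tau)).
have f0 : is_derive (0 : R) 1 f 0.
  (* Chain rule: P_l'(1) times nu3'(0) is l(l+1)/2 times -2. *)
  have H1 : is_derive (0 : R) 1 (horner (legendre R l) \o @nu3 R) (- (l * l.+1)%:R).
    have HP := is_derive_poly (legendre R l) (nu3 0).
    apply: (is_derive_eq (is_derive1_comp HP nu3_is_derive0)).
    by rewrite nu30 legendre_deriv1; field.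
  have H2 : is_derive (0 : R) 1 (expR \o (- (l * l.+1)%:R \*: id)) (- (l * l.+1)%:R).
    have HZ := is_deriveZ (- (l * l.+1)%:R) (is_derive_id (0 : R) 1).
    apply: (is_derive_eq (is_derive1_comp _ HZ)).
    by rewrite [_ 0](scaler0 _ _) expR0 mul1r; exact: mulr1.
  have HB := is_deriveB H1 H2.
  have -> : f = (horner (legendre R l) \o @nu3 R) - (expR \o (- (l * l.+1)%:R \*: id)).
    by apply/funext => tau; rewrite /f !fctE /= -[_ *: _]/(_ * _) mulNr.
  by apply: (is_derive_eq HB); rewrite subrr.
have pi0 : pi != 0 :> R by rewrite gt_eqF ?pi_gt0.
have f00 : f 0 = 0 by rewrite /f nu30 legendre1 mulr0 oppr0 expR0 subrr.
have := is_derive_cvg_right f0.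
apply: cvg_trans; apply: near_eq_cvg; near=> tau.
have tau0 : 0 < tau by near: tau; exact: nbhs_right_gt.
rewrite /int_diff /D3 Rintegral_delta ?integral_heat //.
- rewrite add0r f00 subr0 /f; move: pi pi0 => p p0.
  by field; rewrite p0 gt_eqF.
- exact: nu3_itv.
- exact/measurable_EFinP/measurable_int/integrable_horner.
Unshelve. all: by end_near. Qed.

End delta.

Theorem proposition1 (R : realType) :
  [/\ forall tau : R, 0 < tau ->
        (forall A : set (measurableTypeR R), measurable A -> A `<=` `[-1, 1] ->
           (0 <= D3 tau A)%E)
        /\ ((2 * pi)%:E * \int[D3 tau]_(mu in `[(-1)%R, 1%R]) 1 = 1)%E,
      weak_cvg (@D3 R) 0^'+ (delta_kernel 1)
    & forall l : nat, (1 <= l)%N ->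
        (2 * pi / tau
           * int_diff (D3 tau) (fun mu => D mu tau) (fun mu => (legendre R l).[mu]))
          @[tau --> 0^'+] --> (0 : R)].
Proof.
split=> [tau tau0||l _]; [split|exact: weak_cvg_D3|exact: cvg_D3_sub_D].
- by move=> A _ _; exact: measure_ge0.
- exact: total_mass_D3.
Qed.
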